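(* There exists a closed set $F\subset[0,\infty)$ satisfying $$\lim_{t\to\infty}\lambda(F\cap[t,t+1])=1$$ such that $F$ does not contain any infinite arithmetic progression.
   Context: $\lambda$ denotes Lebesgue measure on $\mathbb{R}$. An infinite arithmetic progression is a non-constant sequence $(b+n\Delta)_{n=0}^\infty$ with $b,\Delta\in\mathbb{R}$, $\Delta\ne0$. *)

(* Defs.v *)
From mathcomp Require Import all_boot all_order all_algebra.
From mathcomp Require Import all_classical all_reals all_analysis.
Set Implicit Arguments.
Unset Strict Implicit.
Unset Printing Implicit Defensive.
Import Order.TTheory GRing.Theory Num.Theory.
Import numFieldNormedType.Exports.
Local Open Scope ring_scope.

Definition infinite_AP (R : realType) (u : nat -> R) : Prop :=
  exists b D : R, D != 0 /\ forall n : nat, u n = b + n%:R * D.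

(* Main.v *)
Require Import Defs.
From mathcomp Require Import all_boot all_order all_algebra.
From mathcomp Require Import all_classical all_reals all_analysis.
From mathcomp Require Import zify lra.

(** The set [F] is [0, +oo[ minus open intervals ]a_n, a_n + w_n[, with
    a_{n+1} = a_n + p_n, where w_n tends to 0 and every spacing p_n is at
    least 3.  A unit window then meets at most two consecutive gaps, so the
    density of [F] in it tends to 1 ([cvg_density_compl_gap_union]).

    The work is in choosing the spacings so that every progression b + n D with
    D > 0 falls into a gap.  Relative to a stretch of gaps with constant spacing
    p and constant width w, a progression of step D' slightly less than p moves
    backwards by p - D' at each step.  If p - D' < w it cannot jump over a gap,
    so it enters one as soon as the stretch is long enough for the accumulated
    drift to exceed its initial offset ([drift_hits]).

    Such a tuning is achieved for all D at once by passing to multiples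
    D' = N D.  On level j, that is for 4^j <= n < 4^(j+1) (and n = 0 when
    j = 0), the spacing is
    p = 3 + H_{j+1}, with H_k the k-th partial sum of the harmonic series, and
    the width is w = 3 / (j + 1).  The spacings tend to infinity because the
    harmonic series diverges, by increments comparable to the widths; hence each
    large multiple N D satisfies 1 / (j + 1) <= p - N D < w at some large level
    j ([tuned_level]).  The offset is at most D when the progression of step D
    (not N D) chooses its starting term just after the beginning of the level,
    whereas the drift over 4^j steps is at least 4^j / (j + 1) >= j + 1.  So any
    j >= D large enough gives a hit ([increasing_AP_meets_gaps]).  Progressions
    with negative step leave [0, +oo[. *)

Set Implicit Arguments.
Unset Strict Implicit.
Unset Printing Implicit Defensive.
Import Order.TTheory GRing.Theory Num.Theory.
Import numFieldNormedType.Exports.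
Local Open Scope classical_set_scope.
Local Open Scope ring_scope.

(** * Unions of separated gaps *)

Definition gap_union (R : realType) (a w : nat -> R) : set R :=
  \bigcup_n `]a n, a n + w n[%classic.

Lemma le_of_spacing (R : realType) (a : nat -> R) (d : R) :
  0 <= d -> (forall n, a n + d <= a n.+1) ->
  forall m n, (m <= n)%N -> a m <= a n.
Proof.
move=> d0 spaced m n; apply: (@homo_leq _ a <=%R) => //.
  by move=> y x z; apply: le_trans.
by move=> k; have := spaced k; lra.
Qed.

Lemma unbounded_of_spacing (R : realType) (a : nat -> R) (d : R) :
  0 < d -> (forall n, a n + d <= a n.+1) -> forall x, exists n, x < a n.
Proof.
move=> d0 spaced x.
have lin n : a 0%N + n%:R * d <= a n.
  by elim: n => [|n IH]; [lra | have := spaced n; rewrite -natr1; lra].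
exists (Num.bound ((x - a 0%N) / d)).
apply: lt_le_trans (lin _).
by rewrite -ltrBlDl -ltr_pdivrMr// unstable.ltr_bound.
Qed.

(** With [n] the last index such that [a n <= t], the gaps of smaller index end
    by [t], and those of index above [n.+1] start after [t + 1]. *)
Lemma window_meets_two_gaps (R : realType) (a w : nat -> R) (N : nat) (t : R) :
  (forall n, a n + 3 <= a n.+1) -> (forall n, w n <= 3) -> a N <= t ->
  exists2 n, (N <= n)%N &
    gap_union a w `&` `[t, t + 1] `<=`
      `]a n, a n + w n[ `|` `]a n.+1, a n.+1 + w n.+1[.
Proof.
move=> spaced wle aNt.
have amono := @le_of_spacing R a 3 ltac:(lra) spaced.
have beyond : exists n, t < a n.
  by apply: (@unbounded_of_spacing R a 3) => //; lra.
case: (ex_minnP beyond) => -[|n] tan nmin.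
  by have := amono 0%N N isT; lra.
have ant : a n <= t.
  by rewrite leNgt; apply/negP => /nmin; rewrite ltnn.
have Nn : (N <= n)%N.
  by rewrite leqNgt; apply/negP => nN; have := amono _ _ nN; lra.
exists n => // x [[k _ /=]]; rewrite !in_itv/= => /andP[akx xak] /andP[tx xt].
have [kn|nk|eqkn] := ltngtP k n; last by left; rewrite -eqkn akx.
- by have := amono _ _ kn; have := spaced k; have := wle k; lra.
have [nk2|kn2] := ltnP n.+1 k.
  by have := amono _ _ nk2; have := spaced n.+1; lra.
have -> : n.+1 = k by lia.
by right; rewrite akx.
Qed.

(** The window has measure 1 and is covered by its part outside the gaps together
    with two gaps of vanishing length; subadditivity bounds the former from
    below. *)
Lemma cvg_density_compl_gap_union (R : realType) (a w : nat -> R) :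
  (forall n, a n + 3 <= a n.+1) -> (forall n, 0 < w n <= 3) ->
  w n @[n --> \oo] --> 0 ->
  lebesgue_measure ((`[0, +oo[ `\` gap_union a w) `&` `[t, t + 1]) @[t --> +oo]
    --> 1%:E.
Proof.
move=> spaced wbnd w0.
pose F : set R := `[0, +oo[ `\` gap_union a w.
rewrite -/F.
have mF t : measurable (F `&` `[t, t + 1]).
  apply: measurableI => //; rewrite /F; apply: measurableD => //.
  exact: bigcupT_measurable.
have unit_window (t : R) : lebesgue_measure (`[t, t + 1] : set R) = 1%:E.
  rewrite lebesgue_measure_itv/= lte_fin ltrDl ltr01 -EFinB.
  by congr EFin; lra.
pose mass (t : R) := lebesgue_measure (F `&` `[t, t + 1]).
have upper (t : R) : (mass t <= 1%:E)%E.
  rewrite -(unit_window t) /mass; apply: le_measure.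
  - by rewrite inE; exact: mF.
  - by rewrite inE; exact: measurable_itv.
  - exact: subIsetr.
have finite (t : R) : mass t \is a fin_num.
  by rewrite ge0_fin_numE// (le_lt_trans (upper t))// ltry.
apply/fine_cvgP; split; first exact: nearW.
apply/cvgrPdist_le => /= e e0.
have /cvgrPdist_le/(_ (e / 2))[|N _ wN] := w0; first lra.
near=> t.
have aNt : a N <= t by near: t; apply: nbhs_pinfty_ge; exact: num_real.
have t0 : 0 <= t by near: t; apply: nbhs_pinfty_ge; exact: num_real.
have wle n : w n <= 3 by have := wbnd n; lra.
have [n Nn sub] := window_meets_two_gaps spaced wle aNt.
have gap_len k : lebesgue_measure (`]a k, a k + w k[ : set R) = (w k)%:E.
  rewrite lebesgue_measure_itv/= lte_fin.
  have -> : (a k < a k + w k) = true by have := wbnd k; lra.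
  by rewrite -EFinB; congr EFin; lra.
pose I : set R := `]a n, a n + w n[ `|` `]a n.+1, a n.+1 + w n.+1[.
have mI : measurable I by apply: measurableU; exact: measurable_itv.
have cover : `[t, t + 1] `<=` (F `&` `[t, t + 1]) `|` I.
  move=> x tx; have [Gx|nGx] := pselect (gap_union a w x).
    by right; apply: sub.
  left; split => //; split => //=; move: tx.
  by rewrite /= !in_itv/= => /andP[tx _]; rewrite andbT; lra.
have lower : (1%:E <= mass t + ((w n)%:E + (w n.+1)%:E))%E.
  rewrite /mass -(unit_window t) -!gap_len.
  apply: (@le_trans _ _ (lebesgue_measure ((F `&` `[t, t + 1]) `|` I))).
    apply: le_measure => //; rewrite inE; first exact: measurable_itv.
    by apply: measurableU => //; exact: mF.
  have := measureU2 lebesgue_measure (mF t) mI => /le_trans; apply.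
  by rewrite leeD2l//; apply: measureU2; exact: measurable_itv.
have := upper t; move: lower; rewrite -(fineK (finite t)) -!EFinD !lee_fin /=.
have := wN n Nn; have := wN n.+1 (leqW Nn).
rewrite !sub0r !normrN.
have := ler_norm (w n); have := ler_norm (w n.+1) => *.
by rewrite ler_norml; lra.
Unshelve. all: end_near. Qed.

(** * The gaps to be removed *)

Lemma series_harmonic_mono (R : realType) (m n : nat) :
  (m <= n)%N -> series (harmonic : R ^nat) m <= series harmonic n.
Proof.
apply: (@le_of_spacing R (series harmonic) 0) => // k.
by rewrite seriesSr addr0 lerDl harmonic_ge0.
Qed.

Lemma series_harmonic_unbounded (R : realType) (x : R) :
  exists n, x < series harmonic n.
Proof.
apply: contrapT => bounded; apply: (@dvg_harmonic R).
apply: nondecreasing_is_cvgn.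
  by move=> m n; exact: series_harmonic_mono.
exists x => _ [n _ <-]; rewrite leNgt; apply/negP => xn.
by apply: bounded; exists n.
Qed.

Definition level (n : nat) : nat := trunc_log 4 n.

(** The constant 3 bounds all widths, so that consecutive gaps do not overlap and
    a unit window meets few of them. *)
Definition period (R : realType) (j : nat) : R := 3 + series harmonic j.+1.

(** A step D' is caught at the first level where [period R j] exceeds it by at
    least [harmonic j]; the excess is then less than
    [harmonic j + harmonic j.-1], which is at most [3 * harmonic j]. *)
Definition width (R : realType) (j : nat) : R := 3 * harmonic j.

Definition gap_start (R : realType) : nat -> R := series (period R \o level).

Lemma gap_start_spaced (R : realType) (n : nat) :
  gap_start R n + 3 <= gap_start R n.+1.
Proof.
rewrite /gap_start seriesSr lerD2l /= /period lerDl.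
by rewrite (le_trans _ (@series_harmonic_mono R 0 _ _))// /series/= big_geq.
Qed.

Lemma width_bounds (R : realType) (j : nat) : 0 < width R j <= 3.
Proof.
rewrite /width mulr_gt0 ?harmonic_gt0//=.
by rewrite ler_piMr// /harmonic/= invf_le1 ?ltr0n// ler1n.
Qed.

Lemma cvg_width_level (R : realType) : width R (level n) @[n --> \oo] --> 0.
Proof.
have levelP : level n @[n --> \oo] --> \oo.
  apply/cvgnyPge => j; near=> n.
  rewrite -(@trunc_expnK 4 j isT) leq_trunc_log//.
  by near: n; exists (4 ^ j)%N.
have widthP : width R j @[j --> \oo] --> 0.
  rewrite -(mulr0 (3 : R)).
  by apply: cvgM; [exact: cvg_cst | exact: cvg_harmonic].
exact: cvg_comp levelP widthP.
Unshelve. all: end_near. Qed.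

(** On a level the gaps form an arithmetic progression; a level contains
    4^(j+1) - 4^j = 3 * 4^j indices. *)
Lemma gap_start_block (R : realType) (j m : nat) : (m <= 3 * 4 ^ j)%N ->
  gap_start R (4 ^ j + m) = gap_start R (4 ^ j) + m%:R * period R j.
Proof.
elim: m => [_|m IH mj]; first by rewrite addn0 mul0r addr0.
rewrite addnS {1}/gap_start seriesSr -/(gap_start R) IH ?(ltnW mj)//=.
have -> : level (4 ^ j + m) = j.
  by apply: trunc_log_eq => //; rewrite expnS; lia.
by rewrite -natr1; lra.
Qed.

(** * Progressions fall into the gaps *)

(** Once [N] is so large that [N%:R * D] exceeds [3 + series harmonic J], the
    first level [j] with [N%:R * D <= 3 + series harmonic j] lies beyond [J]: there
    [period R j] exceeds [N%:R * D] by at least its last term [harmonic j], and,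
    by minimality, by less than its last two terms together. *)
Lemma tuned_level (R : realType) (D : R) (J : nat) : 0 < D ->
  exists N j, (J <= j)%N /\ harmonic j <= period R j - N%:R * D < width R j.
Proof.
move=> D0; pose x : R := 3 + series harmonic J.
pose N := Num.bound (x / D).
have xN : x < N%:R * D by rewrite -ltr_pdivrMr// unstable.ltr_bound.
have reached : exists j, N%:R * D <= 3 + series harmonic j.
  have [j hj] := series_harmonic_unbounded (N%:R * D - 3).
  by exists j; move: hj; lra.
case: (ex_minnP reached) => j hj jmin.
have Jj : (J < j)%N.
  rewrite ltnNge; apply/negP => /(@series_harmonic_mono R).
  by move: xN hj; rewrite /x; lra.
exists N, j; split; first exact: ltnW.
case: j Jj hj jmin => // j _ hj jmin.
have {}jmin : 3 + series harmonic j < N%:R * D.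
  by rewrite ltNge; apply/negP => /jmin; rewrite ltnn.
have h_half : (harmonic j : R) <= 2 * harmonic j.+1.
  by rewrite /harmonic/= ler_pdivlMr ?ltr0n// ler_pdivrMl ?ltr0n// -natrM
    ler_nat; lia.
move: hj jmin h_half; rewrite /period /width !seriesSr => hj jmin h_half.
by apply/andP; split; lra.
Qed.

(** A decreasing walk whose steps are shorter than [w] cannot jump over the
    interval between 0 and [w]: its first position below [w] is still positive. *)
Lemma drift_hits (R : realType) (s w y : R) (M : nat) :
  s < w -> 0 < y -> y < M%:R * s + w ->
  exists2 m, (m <= M)%N & 0 < y - m%:R * s < w.
Proof.
move=> sw y0 yM.
have below : exists m, y - m%:R * s < w by exists M; lra.
case: (ex_minnP below) => m hm mmin.
exists m; first by apply: mmin; lra.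
rewrite hm andbT; case: m hm mmin => [|m] hm mmin; first by lra.
have : w <= y - m%:R * s by rewrite leNgt; apply/negP => /mmin; rewrite ltnn.
by rewrite -natr1; lra.
Qed.

Lemma AP_enters (R : realType) (b D T : R) : 0 < D -> b <= T ->
  exists l : nat, T < b + l%:R * D <= T + D.
Proof.
move=> D0 bT; exists (Num.trunc ((T - b) / D)).+1.
have /truncn_itv/andP[lo hi] : 0 <= (T - b) / D by apply: divr_ge0; lra.
move: lo hi; rewrite ler_pdivlMr// ltr_pdivrMr// -natr1 => lo hi.
by apply/andP; split; lra.
Qed.

(** Among the terms of the given progression, those of step [N%:R * D] starting
    from the first term beyond the beginning [T] of a tuned level are followed
    relatively to the gaps of this level. *)
Lemma increasing_AP_meets_gaps (R : realType) (b D : R) : 0 < D ->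
  exists n : nat, gap_union (gap_start R) (width R \o level) (b + n%:R * D).
Proof.
move=> D0.
have [J0 bJ0] := @unbounded_of_spacing R (gap_start R) 3 ltac:(lra)
  (gap_start_spaced R) b.
(* [J0] puts the level beyond [b]; [Num.bound D] makes it long enough. *)
have [N [j [Jj /andP[slow fast]]]] :=
  tuned_level (maxn J0 (Num.bound D)) D0.
move: Jj; rewrite geq_max => /andP[J0j boundj].
have bT : b <= gap_start R (4 ^ j).
  apply/ltW/(lt_le_trans bJ0).
  apply: (@le_of_spacing R (gap_start R) 3) => //; first exact: gap_start_spaced.
  exact: leq_trans J0j (ltnW (ltn_expl j _)).
have [l /andP[lT lD]] := AP_enters D0 bT.
set T := gap_start R (4 ^ j) in bT lT lD.
set s := period R j - N%:R * D in slow fast.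
(* The total drift over 4^j steps is at least 4^j / (j + 1) >= j + 1 > D. *)
have long : D <= (4 ^ j)%:R * s.
  have Dj : D < j.+1%:R.
    by apply: lt_le_trans (unstable.ltr_bound D) _; rewrite ler_nat leqW.
  have squares : (j.+1%:R * j.+1%:R : R) <= (4 ^ j)%:R.
    rewrite -natrM ler_nat (_ : 4 = 2 * 2)%N// expnMn.
    by rewrite leq_mul// ltn_expl.
  have : (4 ^ j)%:R * harmonic j <= (4 ^ j)%:R * s by rewrite ler_wpM2l.
  apply: le_trans; apply: le_trans (ltW Dj) _.
  by rewrite /harmonic/= ler_pdivlMr ?ltr0n.
have w0 : 0 < width R j by have /andP[] := width_bounds R j.
have y0 : 0 < b + l%:R * D - T by rewrite subr_gt0.
have yM : b + l%:R * D - T < (4 ^ j)%:R * s + width R j by lra.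
have [m mj /andP[ylo yhi]] := drift_hits fast y0 yM.
have mj3 : (m <= 3 * 4 ^ j)%N by lia.
exists (l + m * N)%N, (4 ^ j + m)%N => //=.
have -> : level (4 ^ j + m) = j.
  by apply: trunc_log_eq => //; rewrite expnS; have := expn_gt0 4 j; lia.
rewrite in_itv/= gap_start_block// -/T natrD natrM.
move: ylo yhi; rewrite /s => ylo yhi.
by apply/andP; split; lra.
Qed.

Theorem theorem1p4 (R : realType) :
  exists F : set R,
    [/\ closed F,
        F `<=` `[0, +oo[,
        lebesgue_measure (F `&` `[t, t + 1]) @[t --> +oo] --> 1%:E
      & ~ exists u : nat -> R, infinite_AP u /\ range u `<=` F].
Proof.
pose G := gap_union (gap_start R) (width R \o level).
have openG : open G by apply: bigcup_open => n _; exact: itv_open.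
exists (`[0, +oo[ `\` G); split.
- by rewrite setDE; apply: closedI;
    [exact: interval_closed | exact: open_closedC].
- exact: subDsetl.
- apply: cvg_density_compl_gap_union.
  + exact: gap_start_spaced.
  + by move=> n; exact: width_bounds.
  + exact: cvg_width_level.
move=> [u [[b [D [D_neq0 uE]]] uF]].
have uFn n : (`[0, +oo[ `\` G) (b + n%:R * D).
  by rewrite -uE; apply: uF; exists n.
have [D_lt0|D_gt0|/eqP] := ltgtP D 0; last by rewrite (negPf D_neq0).
(* For a negative step, the increasing progression [0 + l * (- D)] exceeds [b]
   for some [l], and then [b + l * D] is negative. *)
- have [l /andP[bl _]] := @AP_enters R 0 (- D) (Num.max 0 b) ltac:(lra)
    ltac:(by rewrite le_max lexx).
  have [/=] := uFn l; rewrite in_itv/= andbT => ul0 _.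
  have : b <= Num.max 0 b by rewrite le_max lexx orbT.
  by lra.
- have [n Gn] := increasing_AP_meets_gaps b D_gt0.
  by have [_] := uFn n.
Qed.
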